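(* Assume the pair $(\mathcal D,\mathcal F)$ is good. Then for every $\varepsilon\in(0,1/4)$, $$\mathrm{RiskA}(\varepsilon)\le \theta(\varepsilon)\,\mathrm{Risk}_*(\varepsilon),\qquad \theta(\varepsilon)=\frac{2\ln(2/\varepsilon)}{\ln(1/(4\varepsilon))}.$$
   Context: Let $(\Omega,P)$ be a Polish space equipped with a $\sigma$-finite Borel measure $P$, let $\mathcal M\subset\mathbb R^m$, and let $\mathcal D=\{p_\mu\}_{\mu\in\mathcal M}$ be a parametric density family: for each $\mu\in\mathcal M$, $p_\mu$ is a nonnegative Borel function on $\Omega$ with $\int_\Omega p_\mu\,dP=1$. Let $\mathcal F$ be a finite-dimensional linear space of Borel functions on $\Omega$ containing the constants. The pair $(\mathcal D,\mathcal F)$ is called good if: (1) $\mathcal M$ is an open convex subset of $\mathbb R^m$; (2) $p_\mu(\omega)>0$ for all $\mu\in\mathcal M$, $\omega\in\Omega$; (3) for all $\mu,\nu\in\mathcal M$ the function $\omega\mapsto\ln(p_\mu(\omega)/p_\nu(\omega))$ belongs to $\mathcal F$; (4) for every $\phi\in\mathcal F$ the function $\mu\mapsto\ln\int_\Omega e^{\phi(\omega)}p_\mu(\omega)P(d\omega)$ is well defined (finite) and concave on $\mathcal M$. Let $X\subset\mathbb R^n$ be a nonempty convex compact set, $x\mapsto A(x)$ an affine map $\mathbb R^n\to\mathbb R^m$ with $A(X)\subset\mathcal M$, and $g\in\mathbb R^n$. An observation $\omega$ has density $p_{A(x)}$ w.r.t. $P$ for an unknown $x\in X$; the goal is to estimate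 $g^Tx$. An estimate is a Borel function $\hat g:\Omega\to\mathbb R$; it is called affine if $\hat g\in\mathcal F$. For $\varepsilon\in(0,1)$ the $\varepsilon$-risk of $\hat g$ is $\mathrm{Risk}(\hat g;\varepsilon)=\inf\{\delta:\ \sup_{x\in X}\mathrm{Prob}_{\omega\sim p_{A(x)}}\{|\hat g(\omega)-g^Tx|>\delta\}<\varepsilon\}$; $\mathrm{Risk}_*(\varepsilon)=\inf_{\hat g}\mathrm{Risk}(\hat g;\varepsilon)$, the infimum over all Borel estimates; $\mathrm{RiskA}(\varepsilon)=\inf_{\phi\in\mathcal F}\mathrm{Risk}(\phi;\varepsilon)$. *)

(* Defs.v *)
From mathcomp Require Import all_boot all_order all_algebra.
From mathcomp Require Import all_classical all_reals all_analysis.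
Import Order.TTheory GRing.Theory Num.Theory.
Import numFieldNormedType.Exports.

Set Implicit Arguments.
Unset Strict Implicit.
Unset Printing Implicit Defensive.

Local Open Scope classical_set_scope.
Local Open Scope ring_scope.

Notation borel_space T := (g_sigma_algebraType (@open T)).

Definition separable_space (T : topologicalType) : Prop :=
  exists D : set T, countable D /\ closure D = setT.

Section Defs.
Variables (R : realType) (d : measure_display) (Omega : measurableType d).
Variable (P : {measure set Omega -> \bar R}).

Definition is_density (f : Omega -> R) : Prop :=
  [/\ measurable_fun setT f, (forall w, 0 <= f w) &
      (\int[P]_w (f w)%:E = 1)%E].

Definition fin_dim_space (F : set (Omega -> R)) : Prop :=
  [/\ exists (k : nat) (b : 'I_k -> Omega -> R),
        F = [set f | exists c : 'I_k -> R,
                       f = (fun w => \sum_(i < k) c i * b i w)],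
      (forall f, F f -> measurable_fun setT f) &
      (forall c : R, F (fun _ => c))].

Definition convex_rV (m : nat) (M : set 'rV[R]_m) : Prop :=
  forall x y (t : R), M x -> M y -> 0 <= t <= 1 ->
    M (t *: x + (1 - t) *: y).

Definition concave_on (m : nat) (M : set 'rV[R]_m) (f : 'rV[R]_m -> R) :
    Prop :=
  forall x y (t : R), M x -> M y -> 0 <= t <= 1 ->
    t * f x + (1 - t) * f y <= f (t *: x + (1 - t) *: y).

Definition exp_moment (m : nat) (p : 'rV[R]_m -> Omega -> R)
    (phi : Omega -> R) (mu : 'rV[R]_m) : \bar R :=
  (\int[P]_w (expR (phi w) * p mu w)%:E)%E.

Definition good_pair (m : nat) (M : set 'rV[R]_m)
    (p : 'rV[R]_m -> Omega -> R) (F : set (Omega -> R)) : Prop :=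
  [/\ open M /\ convex_rV M,
      (forall mu w, M mu -> 0 < p mu w),
      (forall mu nu, M mu -> M nu -> F (fun w => ln (p mu w / p nu w))) &
      (forall phi, F phi ->
         (forall mu, M mu -> exp_moment p phi mu \is a fin_num) /\
         concave_on M (fun mu => ln (fine (exp_moment p phi mu))))].

Definition prob_dens (f : Omega -> R) (S : set Omega) : \bar R :=
  (\int[P]_(w in S) (f w)%:E)%E.

Definition lin_form (n : nat) (g x : 'rV[R]_n) : R :=
  \sum_(i < n) g 0 i * x 0 i.

Definition affine_map (n m : nat) (B : 'M[R]_(n, m)) (a : 'rV[R]_m)
    (x : 'rV[R]_n) : 'rV[R]_m := x *m B + a.

Definition risk (n m : nat) (p : 'rV[R]_m -> Omega -> R)
    (X : set 'rV[R]_n) (B : 'M[R]_(n, m)) (a : 'rV[R]_m) (g : 'rV[R]_n)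
    (ghat : Omega -> R) (eps : R) : \bar R :=
  ereal_inf [set delta%:E | delta in
    [set delta : R |
      (ereal_sup [set prob_dens (p (affine_map B a x))
                     [set w | (delta < `|ghat w - lin_form g x|)%R]
                 | x in X] < eps%:E)%E]].

Definition risk_star (n m : nat) (p : 'rV[R]_m -> Omega -> R)
    (X : set 'rV[R]_n) (B : 'M[R]_(n, m)) (a : 'rV[R]_m) (g : 'rV[R]_n)
    (eps : R) : \bar R :=
  ereal_inf [set risk p X B a g ghat eps | ghat in
              [set h : Omega -> R | measurable_fun setT h]].

Definition riskA (n m : nat) (p : 'rV[R]_m -> Omega -> R)
    (F : set (Omega -> R))
    (X : set 'rV[R]_n) (B : 'M[R]_(n, m)) (a : 'rV[R]_m) (g : 'rV[R]_n)
    (eps : R) : \bar R :=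
  ereal_inf [set risk p X B a g phi eps | phi in F].

End Defs.

Definition theta (R : realType) (eps : R) : R :=
  2 * ln (2 / eps) / ln (1 / (4 * eps)).

(* Main.v *)
From Stdlib Require List.
Require Import Defs.
From mathcomp Require Import all_boot all_order all_algebra.
From mathcomp Require Import all_classical all_reals all_analysis.
From mathcomp Require Import measurable_realfun ring lra.
Import Order.TTheory GRing.Theory Num.Theory.
Import numFieldNormedType.Exports.
Local Open Scope classical_set_scope.
Local Open Scope ring_scope.

(* Write [L psi mu] for the log-moment [ln E_mu e^psi], [r = ln (2/eps)] and
   [Phi (psi, al) (x, y) = g x - g y + al (L (-psi) (A x) + L psi (A y) + 2 r)].
   Upper bound: if [Phi (psi, al) <= c] on [X * X], then by Chernoff's inequality
   a suitable shift of [al psi] has risk at most [c / 2]. As [Phi] is concave in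
   [(x, y)] and, after the change of variable [phi = al psi], convex in
   [(psi, al)], a minimax argument reduces finding such a [(psi, al)] to finding
   one for each single [(x, y)]. The optimal [psi] is half the log-likelihood
   ratio, for which [L (-psi) (A x) + L psi (A y)] is twice the log-affinity
   [ln \int sqrt (p_(A x) p_(A y)) dP], so every [c > G r] works, where
   [G s] is the supremum of [g x - g y] over the pairs of log-affinity at
   least [-s].
   Lower bound: an estimate of risk [delta] tests [x] against [y] with errors
   below [eps] as soon as [g x - g y > 2 delta], which forces the affinity below
   [2 sqrt eps]; hence [G s0 <= 2 delta] for [s0 = ln (1 / (4 eps)) / 2].
   The log-affinity decays at most linearly along the segment from [y] to [x],
   so [G r <= (r / s0) G s0], and [r / s0 = theta eps]. *)

(** * Minimax and concave functions *)

(** Fan's form of concavity: [w] stands in for the combination of [u] and [v] and must serve every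
    [i] in [J] at once, so [Z] carries no linear structure. [convexlike] is the counterpart in the
    index. *)
Definition concavelike {R : realType} {Z I : Type} (K : set Z) (J : set I)
    (f : I -> Z -> R) : Prop :=
  forall u v s, K u -> K v -> 0 <= s <= 1 ->
    exists2 w, K w & forall i, J i -> s * f i u + (1 - s) * f i v <= f i w.

Definition convexlike {R : realType} {Z I : Type} (K : set Z) (J : set I)
    (f : I -> Z -> R) : Prop :=
  forall i j s, J i -> J j -> 0 <= s <= 1 ->
    exists2 k, J k & forall z, K z -> f k z <= s * f i z + (1 - s) * f j z.

Section Minimax.
Context {R : realType} {Z I : Type} (J : set I) (f : I -> Z -> R).

(** The values [(f i z, f j z)] avoid the open positive quadrant, and [(s, 1 - s)] is the normal of
    a separating line through the origin. Points with [0 < f j] bound [s] from below, points with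
    [0 < f i] bound it from above. *)
Lemma pair_minimax (K : set Z) (i j : I) :
  J i -> J j -> concavelike K J f ->
  (forall z, K z -> f i z <= 0 \/ f j z <= 0) ->
  exists2 s, 0 <= s <= 1 & forall z, K z -> s * f i z + (1 - s) * f j z <= 0.
Proof.
move=> Ji Jj cvK ij.
(* Cleared of denominators: each lower bound on [s] is at most each upper bound. Otherwise
   [concavelike] would give a point with both values positive. *)
have cross u v : K u -> K v -> 0 < f i u -> 0 < f j v ->
    f i u * f j v <= f i v * f j u.
  move=> Ku Kv iu jv; rewrite leNgt; apply/negP => lt.
  have ju : f j u <= 0 by case: (ij u Ku) => // /(lt_le_trans iu); rewrite ltxx.
  have iv : f i v <= 0 by case: (ij v Kv) => // /(lt_le_trans jv); rewrite ltxx.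
  (* [s] is chosen so that both values below are positive multiples of
     [f i u * f j v - f i v * f j u] *)
  pose D := f j v - f i v + f i u - f j u.
  have D0 : 0 < D by rewrite /D; lra.
  pose s := (f j v - f i v) / D.
  have s01 : 0 <= s <= 1.
    by rewrite /s divr_ge0 ?ler_pdivrMr ?mul1r ?(ltW D0)//= /D; lra.
  have sE : 1 - s = (f i u - f j u) / D by rewrite /s /D; field; rewrite -/D; lra.
  have [w Kw fw] := cvK u v s Ku Kv s01.
  have [iw|jw] := ij w Kw.
  - have := le_trans (fw i Ji) iw; rewrite sE /s.
    suff : 0 < (f j v - f i v) / D * f i u + (f i u - f j u) / D * f i v by lra.
    rewrite [ltRHS](_ : _ = (f i u * f j v - f i v * f j u) / D); last by ring.
    by rewrite divr_gt0// subr_gt0.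
  - have := le_trans (fw j Jj) jw; rewrite sE /s.
    suff : 0 < (f j v - f i v) / D * f j u + (f i u - f j u) / D * f j v by lra.
    rewrite [ltRHS](_ : _ = (f i u * f j v - f i v * f j u) / D); last by ring.
    by rewrite divr_gt0// subr_gt0.
(* [S] collects the lower bounds on [s]; including [0] makes [S] nonempty and [sup S]
   nonnegative. *)
pose S := [set s | s = 0 \/
  exists v, [/\ K v, 0 < f j v & s = f j v / (f j v - f i v)]].
have S1 : ubound S 1.
  move=> _ [->|[v [Kv jv ->]]]//.
  have iv : f i v <= 0 by case: (ij v Kv) => // /(lt_le_trans jv); rewrite ltxx.
  by rewrite ler_pdivrMr; lra.
have S0 : S 0 by left.
have hS : has_ubound S by exists 1.
exists (sup S).
  by rewrite ub_le_sup// ge_sup//; exists 0.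
have s01 : 0 <= sup S <= 1 by rewrite ub_le_sup// ge_sup//; exists 0.
move=> z Kz.
have [jz|jz] := ltP 0 (f j z).
  have iz : f i z <= 0 by case: (ij z Kz) => // /(lt_le_trans jz); rewrite ltxx.
  have : f j z / (f j z - f i z) <= sup S.
    by apply: ub_le_sup => //; right; exists z.
  by rewrite ler_pdivrMr; lra.
have [iz|iz] := ltP 0 (f i z); last by nra.
have : sup S <= - f j z / (f i z - f j z).
  apply: ge_sup; first by exists 0.
  move=> _ [->|[v [Kv jv ->]]]; first by rewrite divr_ge0; lra.
  have iv : f i v <= 0 by case: (ij v Kv) => // /(lt_le_trans jv); rewrite ltxx.
  have := cross z v Kz Kv iz jv.
  rewrite ler_pdivrMr; last lra.
  rewrite mulrAC ler_pdivlMr; last lra.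
  nra.
by rewrite ler_pdivlMr; lra.
Qed.

Lemma finite_minimax (l : seq I) (i0 : I) (K : set Z) :
  J i0 -> concavelike K J f -> convexlike K J f ->
  (forall z, K z ->
    f i0 z <= 0 \/ exists i, [/\ List.In i l, J i & f i z <= 0]) ->
  exists2 i, J i & forall z, K z -> f i z <= 0.
Proof.
(* Where [f j <= 0] nothing is needed, so the induction hypothesis is applied on
   [K] cut by [0 < f j], which remains concavelike. *)
move=> Ji0; elim: l K => [|j l IH] K cc cv H.
  by exists i0 => // z /H[//|[i []]].
have [Jj|nJj] := pselect (J j); last first.
  apply: IH => // z /H[|[i [/= [<-|il] Ji iz]]]//; first by left.
  by right; exists i.
have [|||i Ji fi] := IH (K `&` [set z | 0 < f j z]).
- move=> u v s [Ku /= u0] [Kv /= v0] s01.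
  have [w Kw fw] := cc u v s Ku Kv s01; exists w => //; split => //=.
  by apply: lt_le_trans (fw _ Jj); nra.
- move=> i k s Ji Jk s01; have [h Jh fh] := cv i k s Ji Jk s01.
  by exists h => // z [Kz _]; exact: fh.
- move=> z [Kz /= z0]; have [|[i [/= [<-|il] Ji iz]]] := H z Kz.
  + by left.
  + by move: z0; rewrite ltNge iz.
  + by right; exists i.
(* Now [f i <= 0] wherever [0 < f j], so [i] and [j] merge into one weighted sum, and [convexlike]
   turns that sum into a single index. *)
have [|s s01 fs] := @pair_minimax K i j Ji Jj cc.
  move=> z Kz; have [z0|z0] := ltP 0 (f j z); last by right.
  by left; apply: fi.
have [k Jk fk] := cv i j s Ji Jj s01.
by exists k => // z Kz; apply: le_trans (fk z Kz) (fs z Kz).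
Qed.

End Minimax.

Lemma compact_minimax (R : realType) (Z : topologicalType) (I : Type)
    (K : set Z) (J : set I) (f : I -> Z -> R) :
  compact K -> J !=set0 -> concavelike K J f -> convexlike K J f ->
  (forall z, K z -> exists2 i, J i & \forall y \near z, f i y <= 0) ->
  exists2 i, J i & forall z, K z -> f i z <= 0.
Proof.
move=> /compact_near_coveringP cK [i0 Ji0] cc cv H.
(* Lists directed by inclusion of their members: near-covering compactness along this filter
   produces a finite list of indices that serves all of [K]. *)
pose G := filter_from [set: seq I]
  (fun l0 => [set l | forall i, List.In i l0 -> List.In i l]).
have FG : Filter G.
  apply: filter_from_filter; first by exists [::].
  move=> l1 l2 _ _; exists (l1 ++ l2) => // l ll.
  by split => i il; apply: ll; apply: List.in_or_app; [left|right].
have [z Kz|l _ /(_ l (fun _ => id)) Kl] :=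
    cK _ G (fun l z => exists i, [/\ List.In i l, J i & f i z <= 0]) FG.
- have [i Ji iz] := H z Kz.
  exists ([set y | f i y <= 0], [set l | List.In i l]).
    by split => //=; exists [:: i] => // l /= ll; apply: ll; left.
  by move=> [y l] /= [iy il]; exists i.
by apply: (@finite_minimax _ _ _ J f l i0 K) => // z /Kl; right.
Qed.

(** * Continuity of concave functions on open sets *)

Section ConcaveContinuous.
Context {R : realType} {m : nat} {M : set 'rV[R]_m} {f : 'rV[R]_m -> R}.
Context {x : 'rV[R]_m} (oM : open M) (cM : convex_rV M) (fM : concave_on M f) (Mx : M x).

Let half_double (u : 'rV[R]_m) : 2^-1 *: (u + u) = u.
Proof. by rewrite -mulr2n -scalerMnr scalerMnl -mulr_natr mulVf// scale1r. Qed.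

(** On the segment from [x] to [x + r v] or [x - r v], a concave function lies above its chord. The
    sum of the two absolute chord slopes serves as [C] in both directions. *)
Lemma concave_lower_lipschitz_dir (v : 'rV[R]_m) :
  exists C r : R, [/\ 0 <= C, 0 < r & forall a e, `|a| <= e -> e <= r ->
    M (x + a *: v) /\ f x - C * e <= f (x + a *: v)].
Proof.
have : \forall a \near (0 : R), M (x + a *: v).
  have : (fun a : R => x + a *: v) a @[a --> (0:R)] --> x + 0 *: v.
    by apply: cvgD; [exact: cvg_cst|apply: cvgZr_tmp; exact: cvg_id].
  by apply; rewrite scale0r addr0; exact: open_nbhs_nbhs.
move=> /nbhs_ballP[r0 /= r00 Hr0].
pose r := r0 / 2.
have r1 : 0 < r by rewrite /r divr_gt0.
have MV a : `|a| <= r -> M (x + a *: v).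
  move=> ar; apply: Hr0; rewrite /ball/= sub0r normrN.
  by apply: le_lt_trans ar _; rewrite /r; lra.
pose C := (`|f x - f (x + r *: v)| + `|f x - f (x + (- r) *: v)|) / r.
have C0 : 0 <= C by rewrite divr_ge0 ?addr_ge0// ltW.
exists C, r; split => // a e ae er.
have ar := le_trans ae er; split; first exact: MV.
have e0 : 0 <= e by apply: le_trans ae.
have main b : `|b| = r -> `|f x - f (x + b *: v)| <= C * r ->
    f x - C * e <= f (x + (`|a| / r) *: (b *: v)).
  move=> br hb.
  have t01 : 0 <= `|a| / r <= 1.
    by rewrite divr_ge0 ?(ltW r1)//= ler_pdivrMr// mul1r.
  have := fM _ x _ (MV b _) Mx t01; rewrite br lexx => /(_ isT).
  rewrite (_ : _ *: (x + _) + _ = x + (`|a| / r) *: (b *: v)); last first.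
    by rewrite scalerDr addrAC -scalerDl (addrC (`|a| / r)) subrK scale1r.
  apply: le_trans.
  have : `|a| / r * (f x - f (x + b *: v)) <= C * `|a|.
    rewrite mulrAC ler_pdivrMr// (mulrC C) -mulrA ler_wpM2l//.
    exact: le_trans (ler_norm _) hb.
  have : C * `|a| <= C * e by rewrite ler_wpM2l.
  lra.
have [a0|a0] := leP 0 a.
  have := main r; rewrite scalerA (ger0_norm a0) (gtr0_norm r1).
  by rewrite !divfK ?gt_eqF//; apply => //; rewrite lerDl.
have := main (- r); rewrite scalerA.
have -> : `|a| / r * - r = a by rewrite ltr0_norm// mulrN divfK ?gt_eqF ?opprK.
rewrite normrN gtr0_norm//; apply => //.
by rewrite /C divfK ?gt_eqF// lerDr.
Qed.

(** Induction on the number of directions: [x] plus the sum is the midpoint of [x + 2 c_j v_j] and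
    [x] plus twice the remaining sum. The doubled coefficients are why the radius is halved. *)
Lemma concave_lower_lipschitz (J : Type) (v : J -> 'rV[R]_m) (s : seq J) :
  exists C r : R, [/\ 0 <= C, 0 < r & forall (c : J -> R) e, e <= r ->
    (forall j, `|c j| <= e) -> M (x + \sum_(j <- s) c j *: v j) /\
    f x - C * e <= f (x + \sum_(j <- s) c j *: v j)].
Proof.
elim: s => [|j s [C1 [r1 [C10 r10 H1]]]].
  exists 0, 1; split => // c e _ _.
  by rewrite big_nil addr0 mul0r subr0.
have [C2 [r2 [C20 r20 H2]]] := concave_lower_lipschitz_dir (v j).
exists (C1 + C2), (Num.min r1 r2 / 2); split.
- by rewrite addr_ge0.
- by rewrite divr_gt0// lt_min r10.
move=> c e; rewrite ler_pdivlMr// le_min => /andP[er1 er2] ce.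
have cN k : `|2 * c k| <= e * 2 by rewrite normrM ger0_norm// mulrC ler_wpM2r.
have [M1 f1] := H1 (fun j => 2 * c j) (e * 2) er1 cN.
have [M2 f2] := H2 (2 * c j) (e * 2) (cN j) er2.
have h01 : 0 <= (2^-1 : R) <= 1 by lra.
have E : x + \sum_(i <- j :: s) c i *: v i =
    2^-1 *: (x + \sum_(j <- s) (2 * c j) *: v j) +
    (1 - 2^-1) *: (x + (2 * c j) *: v j).
  rewrite big_cons (_ : 1 - 2^-1 = 2^-1 :> R); last lra.
  rewrite -scalerDr addrACA scalerDr half_double.
  under [X in _ = x + _ *: (X + _)]eq_bigr do rewrite -scalerA.
  rewrite -scaler_sumr -(scalerA 2 (c j)) -scalerDr scalerA mulVf// scale1r.
  by rewrite (addrC (c j *: _)).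
have := fM _ _ _ M1 M2 h01; rewrite -E => fE; split; last lra.
by rewrite E; exact: cM.
Qed.

Lemma concave_continuous : {for x, continuous f}.
Proof.
have [C [r [C0 r0 H]]] :=
  @concave_lower_lipschitz _ (fun j => delta_mx 0 j) (index_enum 'I_m).
suff : f y @[y --> nbhs x] --> f x by [].
apply/(cvgrPdist_le (F := nbhs x)) => e e0.
pose d := Num.min r (e / (C + 1)).
have C1 : 0 < C + 1 by rewrite ltr_wpDl.
have d0 : 0 < d by rewrite lt_min r0 divr_gt0.
apply/nbhs_ballP; exists d => //= y xyd.
have yd j : `|(y - x) 0 j| <= d.
  have [_ /(_ 0 j)] := xyd; rewrite /ball/= distrC !mxE; exact: ltW.
have dr : d <= r by rewrite ge_min lexx.
have Cd : C * d <= e.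
  have : d <= e / (C + 1) by rewrite ge_min lexx orbT.
  by rewrite ler_pdivlMr//; nra.
have E (h : 'rV[R]_m) : \sum_(j <- index_enum 'I_m) h 0 j *: delta_mx 0 j = h.
  by rewrite -row_sum_delta.
(* The lower bound is used at [y] and at its reflection [2 x - y]. As [x] is their midpoint,
   concavity turns the second bound into an upper bound for [f y]. *)
have [M1 f1] := H (fun j => (y - x) 0 j) d dr yd.
have [|M2 f2] := H (fun j => (x - y) 0 j) d dr _.
  by move=> j; rewrite -opprB mxE normrN.
rewrite !E in M1 f1 M2 f2.
have h01 : 0 <= (2^-1 : R) <= 1 by lra.
have := fM _ _ _ M1 M2 h01.
rewrite (_ : _ *: _ + _ = x); last first.
  rewrite (_ : 1 - 2^-1 = 2^-1 :> R); last lra.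
  by rewrite -scalerDr addrACA -(opprB x y) addNr addr0 half_double.
rewrite (addrC x (y - x)) subrK in f1 *.
by rewrite ler_norml; lra.
Qed.

End ConcaveContinuous.

Set Implicit Arguments.
Unset Strict Implicit.

(** * Exponential moments and affinity *)

Lemma expR_amgm (R : realType) (a b : R) :
  2 * expR ((a + b) / 2) <= expR a + expR b.
Proof.
have e2 (c : R) : expR c = expR (c / 2) ^+ 2 by rewrite -expRM_natr; congr expR; lra.
rewrite (mulrDl a b) expRD (e2 a) (e2 b).
have := sqr_ge0 (expR (a / 2) - expR (b / 2)); lra.
Qed.

Lemma expR_convex (R : realType) (a b t : R) : 0 <= t <= 1 ->
  expR (t * a + (1 - t) * b) <= t * expR a + (1 - t) * expR b.
Proof.
move=> /andP[t0 t1].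
pose c := t * a + (1 - t) * b.
(* The tangent line of the exponential at [c]; its weighted values at [a] and [b] add up to
   [expR c]. *)
have e x : expR c * (1 + (x - c)) <= expR x.
  rewrite -[leRHS](_ : expR c * expR (x - c) = _); last first.
    by rewrite -expRD addrC subrK.
  by rewrite ler_wpM2l ?expR_ge0// expR_ge1Dx.
have ea : t * (expR c * (1 + (a - c))) <= t * expR a by rewrite ler_wpM2l.
have eb : (1 - t) * (expR c * (1 + (b - c))) <= (1 - t) * expR b.
  by rewrite ler_wpM2l ?e// subr_ge0.
apply: le_trans (lerD ea eb).
by rewrite le_eqVlt; apply/orP; left; apply/eqP; rewrite -/c /c; ring.
Qed.

Section Integrals.
Context {R : realType} {d : measure_display} {Omega : measurableType d}.
Context (P : {measure set Omega -> \bar R}).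

Lemma ge0_integral_comb (f0 f1 f2 : Omega -> R) (c0 c1 c2 : R) :
  measurable_fun setT f0 -> measurable_fun setT f1 -> measurable_fun setT f2 ->
  (forall w, 0 <= f0 w) -> (forall w, 0 <= f1 w) -> (forall w, 0 <= f2 w) ->
  0 <= c0 -> 0 <= c1 -> 0 <= c2 ->
  (forall w, c0 * f0 w <= c1 * f1 w + c2 * f2 w) ->
  (c0%:E * \int[P]_w (f0 w)%:E <=
   c1%:E * \int[P]_w (f1 w)%:E + c2%:E * \int[P]_w (f2 w)%:E)%E.
Proof.
move=> m0 m1 m2 f00 f10 f20 c00 c10 c20 H.
have mE (f : Omega -> R) : measurable_fun setT f ->
    measurable_fun setT (EFin \o f).
  by move=> ?; apply/measurable_EFinP.
rewrite -!ge0_integralZl_EFin//; try by [exact: mE | move=> w _; rewrite lee_fin].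
rewrite -ge0_integralD//.
- apply: ge0_le_integral => //.
  + by move=> w _; rewrite mule_ge0 ?lee_fin.
  + by apply: emeasurable_funM => //; exact: mE.
  + by apply: emeasurable_funD; apply: emeasurable_funM => //; exact: mE.
  + by move=> w _; rewrite -!EFinM -EFinD lee_fin.
- by move=> w _; rewrite mule_ge0 ?lee_fin.
- by apply: emeasurable_funM => //; exact: mE.
- by move=> w _; rewrite mule_ge0 ?lee_fin.
- by apply: emeasurable_funM => //; exact: mE.
Qed.

Lemma ge0_integralD_EFin (f g : Omega -> R) :
  measurable_fun setT f -> measurable_fun setT g ->
  (forall w, 0 <= f w) -> (forall w, 0 <= g w) ->
  (\int[P]_w (f w + g w)%:E = \int[P]_w (f w)%:E + \int[P]_w (g w)%:E)%E.
Proof.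
move=> mf mg f0 g0; under eq_integral do rewrite EFinD.
rewrite ge0_integralD//; try by [apply/measurable_EFinP | move=> w _; rewrite lee_fin].
Qed.

Lemma measurable_gtr (f : Omega -> R) (c : R) :
  measurable_fun setT f -> measurable [set w | c < f w].
Proof.
move=> mf; rewrite -[X in measurable X]setTI.
rewrite (_ : [set w | _] = f @^-1` `]c, +oo[); first exact: mf.
by apply/seteqP; split => w /=; rewrite in_itv/= andbT.
Qed.

Lemma prob_dens_indic (f : Omega -> R) (S : set Omega) :
  prob_dens P f S = (\int[P]_w (f w * \1_S w)%:E)%E.
Proof. by rewrite /prob_dens integral_mkcond epatch_indic. Qed.

Lemma measurable_mul_indic (f : Omega -> R) (S : set Omega) :
  measurable_fun setT f -> measurable S ->
  measurable_fun setT (fun w => f w * \1_S w).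
Proof. by move=> mf mS; apply: measurable_funM => //; exact: measurable_indic. Qed.

End Integrals.

(** * Moments of a good pair *)

Section GoodPair.
Context {R : realType} {d : measure_display} {Omega : measurableType d}.
Context {P : {measure set Omega -> \bar R}} {m : nat} {M : set 'rV[R]_m}.
Context {p : 'rV[R]_m -> Omega -> R} {F : set (Omega -> R)}.
Context (p_density : forall mu, M mu -> is_density P (p mu)).
Context (F_space : fin_dim_space F) (good : good_pair P M p F).

Lemma fin_dim_space_comb (f g : Omega -> R) (a b : R) :
  F f -> F g -> F (fun w => a * f w + b * g w).
Proof.
have [[k [e ->]] _ _] := F_space => -[c ->] [c' ->].
exists (fun i => a * c i + b * c' i); apply/funext => w.
rewrite !mulr_sumr -big_split/=; apply: eq_bigr => i _; ring.
Qed.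

Lemma fin_dim_spaceN (f : Omega -> R) : F f -> F (fun w => - f w).
Proof.
move=> Ff; rewrite (_ : (fun w => _) = fun w => (-1) * f w + 0 * f w).
  exact: fin_dim_space_comb.
by apply/funext => w; rewrite mulN1r mul0r addr0.
Qed.

Definition moment (phi : Omega -> R) (mu : 'rV[R]_m) : R :=
  fine (exp_moment P p phi mu).

Definition log_moment (phi : Omega -> R) (mu : 'rV[R]_m) : R :=
  ln (moment phi mu).

Lemma momentE phi mu : F phi -> M mu ->
  exp_moment P p phi mu = (moment phi mu)%:E.
Proof. by have [_ _ _ H] := good => /H[fin _] /fin ?; rewrite fineK. Qed.

Lemma measurable_moment phi mu : F phi -> M mu ->
  measurable_fun setT (fun w => expR (phi w) * p mu w).
Proof.
have [_ mF _] := F_space; move=> /mF mphi /p_density[mp _ _].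
apply: measurable_funM => //.
exact: (measurableT_comp (@measurable_expR R)).
Qed.

Lemma moment_integrand_ge0 phi mu w : M mu -> 0 <= expR (phi w) * p mu w.
Proof. by move=> /p_density[_ p0 _]; rewrite mulr_ge0 ?expR_ge0. Qed.

Lemma moment_comb phi0 phi1 phi2 mu0 mu1 mu2 (c0 c1 c2 : R) :
  F phi0 -> F phi1 -> F phi2 -> M mu0 -> M mu1 -> M mu2 ->
  0 <= c0 -> 0 <= c1 -> 0 <= c2 ->
  (forall w, c0 * (expR (phi0 w) * p mu0 w) <=
     c1 * (expR (phi1 w) * p mu1 w) + c2 * (expR (phi2 w) * p mu2 w)) ->
  c0 * moment phi0 mu0 <= c1 * moment phi1 mu1 + c2 * moment phi2 mu2.
Proof.
move=> F0 F1 F2 M0 M1 M2 c00 c10 c20 H.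
have := @ge0_integral_comb _ _ _ P _ _ _ c0 c1 c2 (measurable_moment F0 M0)
  (measurable_moment F1 M1) (measurable_moment F2 M2).
rewrite -!/(exp_moment P p _ _) !momentE// -!EFinM -EFinD lee_fin.
by apply => // w; exact: moment_integrand_ge0.
Qed.

Lemma moment_ge0 phi mu : M mu -> 0 <= moment phi mu.
Proof.
move=> Mmu; rewrite fine_ge0// integral_ge0// => w _.
by rewrite lee_fin moment_integrand_ge0.
Qed.

Lemma moment0 mu : M mu -> moment (fun=> 0) mu = 1.
Proof.
move=> Mmu; rewrite /moment /exp_moment; under eq_integral do rewrite expR0 mul1r.
by have [_ _ ->] := p_density Mmu.
Qed.

Lemma moment_gt0 phi mu : F phi -> M mu -> 0 < moment phi mu.
Proof.
move=> Fphi Mmu; have [_ _ FC] := F_space.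
have FN := fin_dim_spaceN Fphi.
(* Integrating [2 <= k e^phi + k^-1 e^(-phi)] against [p mu] shows that a vanishing moment of [phi]
   would give [2 k <= k - 1]. *)
pose k := moment (fun w => - phi w) mu + 1.
have k0 : 0 < k by rewrite ltr_wpDl ?moment_ge0.
rewrite lt_neqAle moment_ge0// andbT; apply/eqP => E.
have := @moment_comb _ _ _ mu mu mu 2 k k^-1 (FC 0) Fphi FN Mmu Mmu Mmu.
rewrite moment0// -E mulr0 add0r => H.
have : (2 : R) * 1 <= k^-1 * moment (fun w => - phi w) mu.
  apply: H => //; rewrite ?invr_ge0 ?(ltW k0)// => w.
  have [_ p0 _] := p_density Mmu.
  rewrite !mulrA -mulrDl ler_wpM2r// expR0 mulr1.
  have -> : k = expR (ln k) by rewrite lnK.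
  rewrite -expRN -!expRD.
  apply: le_trans (expR_amgm _ _).
  rewrite (_ : (_ + _) / 2 = 0) ?expR0 ?mulr1//; lra.
rewrite ler_pdivlMl// /k; have := moment_ge0 (fun w => - phi w) Mmu; lra.
Qed.

Lemma expR_log_moment phi mu : F phi -> M mu ->
  expR (log_moment phi mu) = moment phi mu.
Proof. by move=> Fphi Mmu; rewrite lnK// posrE moment_gt0. Qed.

Lemma log_moment0 mu : M mu -> log_moment (fun=> 0) mu = 0.
Proof. by move=> Mmu; rewrite /log_moment moment0// ln1. Qed.

Lemma log_moment_concave phi : F phi -> concave_on M (log_moment phi).
Proof. by have [_ _ _ H] := good => /H[]. Qed.

(** Hölder's inequality: once [e^phi] and [e^psi] are divided by their moments, pointwise convexity
    of the exponential integrates to [t + (1 - t)]. *)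
Lemma log_moment_convex phi psi mu t : F phi -> F psi -> M mu -> 0 <= t <= 1 ->
  log_moment (fun w => t * phi w + (1 - t) * psi w) mu <=
  t * log_moment phi mu + (1 - t) * log_moment psi mu.
Proof.
move=> Fphi Fpsi Mmu t01; have Fc := fin_dim_space_comb t (1 - t) Fphi Fpsi.
have [_ p0 _] := p_density Mmu.
have := expR_log_moment Fphi Mmu; have := expR_log_moment Fpsi Mmu.
set a := log_moment phi mu; set b := log_moment psi mu.
move: (a) (b) => {}a {}b eb ea.
have /andP[t0 t1] := t01.
have cancel_exp (x y z : R) : expR x = z -> y * expR (- x) * z = y.
  by move=> <-; rewrite -mulrA -expRD addNr expR0 mulr1.
rewrite -ler_expR expR_log_moment//.
suff : expR (- (t * a + (1 - t) * b)) *
    moment (fun w => t * phi w + (1 - t) * psi w) mu <= t + (1 - t).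
  by rewrite expRN ler_pdivrMl ?expR_gt0// (addrC t) subrK mulr1.
have -> : t + (1 - t) = t * expR (- a) * moment phi mu +
    (1 - t) * expR (- b) * moment psi mu.
  by rewrite !cancel_exp.
apply: moment_comb; rewrite ?mulr_ge0 ?expR_ge0 ?subr_ge0// => w.
rewrite !mulrA -mulrDl ler_wpM2r// -!mulrA -!expRD.
apply: le_trans (expR_convex _ _ t01).
by rewrite ler_expR; lra.
Qed.

(** * Log-likelihood ratios, affinity and tests *)

Definition half_llr (mu nu : 'rV[R]_m) : Omega -> R :=
  fun w => 2^-1 * ln (p nu w / p mu w).

(** The logarithm of the Hellinger affinity, since by [half_llrE] the integrand is the geometric
    mean of the two densities. Written as a log-moment, it inherits the concavity assumed in
    [good_pair]. *)
Definition log_affinity (mu nu : 'rV[R]_m) : R :=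
  log_moment (half_llr mu nu) mu.

Lemma half_llr_in mu nu : M mu -> M nu -> F (half_llr mu nu).
Proof.
have [_ _ H _] := good => Mmu Mnu.
have Fl := H _ _ Mnu Mmu.
rewrite (_ : half_llr _ _ = fun w =>
  2^-1 * ln (p nu w / p mu w) + 0 * ln (p nu w / p mu w)).
  exact: (fin_dim_space_comb _ _ Fl Fl).
by apply/funext => w; rewrite mul0r addr0.
Qed.

Lemma half_llrN mu nu : M mu -> M nu ->
  half_llr nu mu = (fun w => - half_llr mu nu w).
Proof.
have [_ p0 _ _] := good; move=> Mmu Mnu; apply/funext => w.
by rewrite /half_llr !ln_div ?posrE ?p0//; lra.
Qed.

Lemma half_llrE mu nu w : M mu -> M nu ->
  expR (half_llr mu nu w) * p mu w = expR ((ln (p mu w) + ln (p nu w)) / 2).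
Proof.
have [_ p0 _ _] := good; move=> Mmu Mnu.
rewrite -{1}(lnK (p0 mu w Mmu)) -expRD /half_llr ln_div ?posrE ?p0//.
by congr expR; lra.
Qed.

Lemma log_affinity_sym mu nu : M mu -> M nu ->
  log_affinity mu nu = log_moment (half_llr nu mu) nu.
Proof.
move=> Mmu Mnu; rewrite /log_affinity /log_moment /moment /exp_moment.
congr (ln (fine _)); apply: eq_integral => w _.
by rewrite !half_llrE// addrC.
Qed.

(** Cauchy-Schwarz for the factors [e^(-phi) p mu] and [e^phi p nu], whose product is [p mu * p nu].
    Equality holds at [phi = half_llr nu mu]. *)
Lemma log_affinity_le phi mu nu : F phi -> M mu -> M nu ->
  2 * log_affinity mu nu <= log_moment (fun w => - phi w) mu + log_moment phi nu.
Proof.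
move=> Fphi Mmu Mnu; have FN := fin_dim_spaceN Fphi.
have Fh := half_llr_in Mmu Mnu; have [_ p0 _ _] := good.
have := expR_log_moment FN Mmu; have := expR_log_moment Fphi Mnu.
set a := log_moment _ mu; set b := log_moment _ nu.
move: (a) (b) => {}a {}b eb ea.
rewrite -ler_pdivlMl// -ler_expR mulrC expR_log_moment//.
(* [e^k] balances the two terms of the arithmetic-geometric mean inequality *)
pose k := (b - a) / 2.
have ka : expR k * moment (fun w => - phi w) mu = expR ((a + b) / 2).
  by rewrite -ea -expRD /k; congr expR; lra.
have kb : expR (- k) * moment phi nu = expR ((a + b) / 2).
  by rewrite -eb -expRD /k; congr expR; lra.
have : 2 * moment (half_llr mu nu) mu <=
    expR k * moment (fun w => - phi w) mu + expR (- k) * moment phi nu.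
  apply: moment_comb; rewrite ?expR_ge0// => w; rewrite half_llrE//.
  rewrite -[p mu w](lnK (p0 mu w Mmu)) -[p nu w](lnK (p0 nu w Mnu)) !expRK.
  rewrite -!expRD; apply: le_trans (expR_amgm _ _).
  by rewrite ler_wpM2l// ler_expR; lra.
by rewrite ka kb; lra.
Qed.

(* [log_affinity xi nu] is evaluated with the [phi] optimal at [(xi, nu)], where
   concavity of the log-moments applies; at [mu] and [nu] that [phi] is still
   admissible in [log_affinity_le]. *)
Lemma log_affinity_segment mu nu t : M mu -> M nu -> 0 <= t <= 1 ->
  t * log_affinity mu nu <= log_affinity (t *: mu + (1 - t) *: nu) nu.
Proof.
move=> Mmu Mnu t01; have [[_ cM] _ _ _] := good.
set xi := t *: mu + (1 - t) *: nu.
have Mxi : M xi by exact: cM.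
have Fh := half_llr_in Mxi Mnu; have Fh' := half_llr_in Mnu Mxi.
have h1 := log_moment_concave Fh Mmu Mnu t01; rewrite -/xi -/(log_affinity _ _) in h1.
have e1 := half_llrN Mxi Mnu.
have h2 := log_affinity_le Fh' Mmu Mnu.
have h3 := log_affinity_le Fh' Mnu Mnu.
have h4 : log_affinity nu nu = 0.
  rewrite /log_affinity (_ : half_llr nu nu = fun=> 0) ?log_moment0//.
  apply/funext => w; have [_ p0 _ _] := good.
  by rewrite /half_llr divff ?gt_eqF ?p0// ln1 mulr0.
rewrite -(half_llrN Mnu Mxi) in h2 h3.
have h5 := log_affinity_sym Mxi Mnu.
rewrite h4 mulr0 -h5 in h3; rewrite -h5 in h2.
have /andP[t0 t1] := t01; have t1' : 0 <= 1 - t by rewrite subr_ge0.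
(* Weighting [h2] by [t] and [h3] by [1 - t] and bounding the log-moments at [mu] and [nu] by [h1]
   gives twice the claim. *)
have := ler_wpM2l t0 h2; have := ler_wpM2l t1' h3; move: h1; clear.
move: (log_moment _ mu) (log_moment _ nu) (log_affinity mu nu) (log_affinity xi nu).
by move=> x y z u; lra.
Qed.

(** Markov's inequality in exponential form; the two exponentials are meant for the two tails of a
    two-sided error event. *)
Lemma prob_dens_le_moment phi1 phi2 mu (S : set Omega) (c1 c2 : R) :
  F phi1 -> F phi2 -> M mu -> measurable S -> 0 <= c1 -> 0 <= c2 ->
  (forall w, S w -> 1 <= c1 * expR (phi1 w) + c2 * expR (phi2 w)) ->
  (prob_dens P (p mu) S <= (c1 * moment phi1 mu + c2 * moment phi2 mu)%:E)%E.
Proof.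
move=> F1 F2 Mmu mS c10 c20 H; have [mp p0 _] := p_density Mmu.
rewrite prob_dens_indic.
have := @ge0_integral_comb _ _ _ P _ _ _ 1 c1 c2 (measurable_mul_indic mp mS)
  (measurable_moment F1 Mmu) (measurable_moment F2 Mmu).
rewrite -!/(exp_moment P p _ _) !momentE// -!EFinM -EFinD mul1e.
apply => // w; rewrite ?mulr_ge0 ?indic_ge0 ?expR_ge0//.
rewrite mul1r !mulrA -mulrDl mulrC indicE.
have [/set_mem/H Sw|_] := boolP (w \in S); first by rewrite mul1r ler_peMl.
by rewrite mul0r mulr_ge0 ?addr_ge0 ?mulr_ge0 ?expR_ge0.
Qed.

(** With [q = sqrt eps], twice the geometric mean of the densities is at most [q^-1 p mu + q p nu]
    on [S1] and [q p mu + q^-1 p nu] on [S2]. As the two sets cover, integration bounds twice the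
    affinity by [q^-1] times the two error probabilities plus [2 q], which is below [4 q]. *)
Lemma log_affinity_lt_test mu nu (S1 S2 : set Omega) (eps : R) :
  M mu -> M nu -> measurable S1 -> measurable S2 -> S1 `|` S2 = setT ->
  0 < eps -> (prob_dens P (p mu) S1 < eps%:E)%E ->
  (prob_dens P (p nu) S2 < eps%:E)%E ->
  moment (half_llr mu nu) mu < 2 * Num.sqrt eps.
Proof.
move=> Mmu Mnu mS1 mS2 S12 eps0; rewrite !prob_dens_indic => P1 P2.
have [mp p0 p1] := p_density Mmu; have [mq q0 q1] := p_density Mnu.
have Fh := half_llr_in Mmu Mnu; have [_ pos _ _] := good.
pose q := Num.sqrt eps; have qq : eps = q * q by rewrite -expr2 sqr_sqrtr// ltW.
have q_gt0 : 0 < q by rewrite sqrtr_gt0.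
have m1 := measurable_mul_indic mp mS1; have m2 := measurable_mul_indic mq mS2.
have f1 w : 0 <= p mu w * \1_S1 w by rewrite mulr_ge0 ?indic_ge0.
have f2 w : 0 <= p nu w * \1_S2 w by rewrite mulr_ge0 ?indic_ge0.
have I1 : (\int[P]_w (p mu w * \1_S1 w)%:E)%E \is a fin_num.
  rewrite ge0_fin_numE ?(lt_trans P1) ?ltry// integral_ge0// => w _.
  by rewrite lee_fin.
have I2 : (\int[P]_w (p nu w * \1_S2 w)%:E)%E \is a fin_num.
  rewrite ge0_fin_numE ?(lt_trans P2) ?ltry// integral_ge0// => w _.
  by rewrite lee_fin.
have := @ge0_integral_comb _ _ _ P _ _ _ 2 q^-1 q (measurable_moment Fh Mmu)
  (measurable_funD m1 m2) (measurable_funD mp mq).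
rewrite -/(exp_moment P p _ _) momentE// !ge0_integralD_EFin// p1 q1.
rewrite -(fineK I1) -(fineK I2) !lte_fin in P1 P2 *.
move: (fine _) (fine _) P1 P2 => r2 r1.
rewrite (_ : 1 + 1 = 2%:E)%E ?EFinD// -EFinD -!EFinM -EFinD lee_fin.
move=> P2 P1 H.
suff : 2 * moment (half_llr mu nu) mu <= q^-1 * (r1 + r2) + q * 2.
  have : q^-1 * (r1 + r2) < 2 * q.
    by rewrite ltr_pdivrMl// mulrCA -qq; lra.
  by rewrite -/q; lra.
apply: H => [w|w|w||||w]//;
  rewrite ?mulr_ge0 ?addr_ge0 ?expR_ge0 ?invr_ge0 ?(ltW q_gt0)//.
rewrite half_llrE//.
have pmu := lnK (pos mu w Mmu); have pnu := lnK (pos nu w Mnu).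
have pq : q = expR (ln q) by rewrite lnK.
have A1 : 2 * expR ((ln (p mu w) + ln (p nu w)) / 2) <= q^-1 * p mu w + q * p nu w.
  rewrite -{2}pmu -{2}pnu pq -expRN -!expRD; apply: le_trans (expR_amgm _ _).
  by rewrite ler_wpM2l// ler_expR; lra.
have A2 : 2 * expR ((ln (p mu w) + ln (p nu w)) / 2) <= q * p mu w + q^-1 * p nu w.
  rewrite -{2}pmu -{2}pnu pq -expRN -!expRD; apply: le_trans (expR_amgm _ _).
  by rewrite ler_wpM2l// ler_expR; lra.
have q' : 0 <= q^-1 by rewrite invr_ge0 ltW.
have k1 := mulr_ge0 (ltW q_gt0) (p0 w); have k2 := mulr_ge0 (ltW q_gt0) (q0 w).
have k3 := mulr_ge0 q' (f1 w); have k4 := mulr_ge0 q' (f2 w).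
rewrite !mulrDr; have : (S1 `|` S2) w by rewrite S12.
move=> [Sw|Sw].
- apply: le_trans A1 _; move: k3; rewrite indicE mem_set// mulr1; lra.
- apply: le_trans A2 _; move: k4; rewrite [\1_S2 _]indicE mem_set// mulr1; lra.
Qed.

End GoodPair.

(** * Saddle function and risks *)

Lemma theta_gt0 (R : realType) (eps : R) : 0 < eps -> eps < 1 / 4 -> 0 < theta eps.
Proof.
move=> eps0 eps4; rewrite /theta divr_gt0 ?mulr_gt0// ln_gt0//.
  by rewrite ltr_pdivlMr; lra.
by rewrite div1r invf_gt1; lra.
Qed.

Section AffineMaps.
Context {R : realType} {n m : nat}.
Context (B : 'M[R]_(n, m)) (a : 'rV[R]_m) (g : 'rV[R]_n).

Lemma affine_map_segment (x y : 'rV[R]_n) (t : R) :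
  affine_map B a (t *: x + (1 - t) *: y) =
  t *: affine_map B a x + (1 - t) *: affine_map B a y.
Proof.
rewrite /affine_map mulmxDl -!scalemxAl !scalerDr addrACA -scalerDl.
by rewrite (addrC t) subrK scale1r.
Qed.

Lemma lin_form_segment (x y : 'rV[R]_n) (t : R) :
  lin_form g (t *: x + (1 - t) *: y) = t * lin_form g x + (1 - t) * lin_form g y.
Proof.
rewrite /lin_form !mulr_sumr -big_split/=; apply: eq_bigr => i _.
by rewrite !mxE; ring.
Qed.

Lemma affine_map_continuous : continuous (affine_map B a).
Proof.
have cL : continuous (fun y : 'rV[R]_n => \sum_(i < n) y 0 i *: row i B).
  apply: continuous_big => [|i _ x]; first exact: add_continuous.
  by apply: (cvgZr_tmp (FF := nbhs_filter x)); exact: coord_continuous.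
move=> x; rewrite (_ : affine_map B a = (fun y => \sum_(i < n) y 0 i *: row i B) + cst a).
  by apply: (@continuousD R 'rV[R]_m 'rV[R]_n); [exact: cL|exact: cst_continuous].
by apply/funext => y; rewrite /affine_map mulmx_sum_row.
Qed.

Lemma lin_form_continuous : continuous (lin_form g).
Proof.
apply: continuous_big => [|i _ x]; first exact: add_continuous.
by apply: (cvgMl_tmp (FF := nbhs_filter x)); exact: coord_continuous.
Qed.

End AffineMaps.

Section Risk.
Context {R : realType} {d : measure_display} {Omega : measurableType d}.
Context {P : {measure set Omega -> \bar R}} {m : nat} {M : set 'rV[R]_m}.
Context {p : 'rV[R]_m -> Omega -> R} {F : set (Omega -> R)}.
Context (p_density : forall mu, M mu -> is_density P (p mu)).
Context (F_space : fin_dim_space F) (good : good_pair P M p F).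
Context {n : nat} {X : set 'rV[R]_n} (B : 'M[R]_(n, m)) (a : 'rV[R]_m).
Context (g : 'rV[R]_n).
Context (X_nonempty : X !=set0) (X_convex : convex_rV X) (X_compact : compact X).
Context (AX_sub_M : forall x, X x -> M (affine_map B a x)).

Local Notation A := (affine_map B a).
Local Notation L := (log_moment (P := P) (p := p)).
Local Notation worst_error ghat delta := (ereal_sup [set prob_dens P (p (A x))
  [set w | (delta < `|ghat w - lin_form g x|)%R] | x in X]).
Local Notation aff := (log_affinity (P := P) (p := p)).

Definition saddle (r c : R) (t : (Omega -> R) * R) (z : 'rV[R]_n * 'rV[R]_n) : R :=
  lin_form g z.1 - lin_form g z.2 +
  t.2 * (L (fun w => - t.1 w) (A z.1) + L t.1 (A z.2) + 2 * r) - c.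

(** Positivity of [al] allows dividing by it, both in the change of variable [phi = al psi] and in
    the Chernoff bound. *)
Definition saddle_domain : set ((Omega -> R) * R) :=
  [set t | F t.1 /\ 0 < t.2].

Lemma saddle_concavelike r c :
  concavelike (X `*` X) saddle_domain (saddle r c).
Proof.
move=> u v s [u1 u2] [v1 v2] s01.
exists (s *: u.1 + (1 - s) *: v.1, s *: u.2 + (1 - s) *: v.2).
  by split; apply: X_convex.
move=> [psi al] [/= Fpsi al0]; have FN := fin_dim_spaceN F_space Fpsi.
have h1 := log_moment_concave good FN (AX_sub_M u1) (AX_sub_M v1) s01.
have h2 := log_moment_concave good Fpsi (AX_sub_M u2) (AX_sub_M v2) s01.
rewrite /saddle/= !lin_form_segment !affine_map_segment.
have := ler_wpM2l (ltW al0) (lerD h1 h2).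
do 6 move: (L _ _) => ?; do 4 move: (lin_form _ _) => ?; lra.
Qed.

Lemma saddle_convexlike r c : convexlike (X `*` X) saddle_domain (saddle r c).
Proof.
move=> [psi1 a1] [psi2 a2] s [/= F1 a10] [/= F2 a20] /andP[s0 s1].
(* [t] weights the [psi]'s so that [al * psi] is the convex combination of
   [a1 * psi1] and [a2 * psi2] *)
have [al alE] : exists al, al = s * a1 + (1 - s) * a2 by eexists.
have al0 : 0 < al by rewrite alE; nra.
have [t tal] : exists t, al * t = s * a1.
  by exists (s * a1 / al); rewrite mulrC divfK ?gt_eqF.
have e1 : al * (1 - t) = (1 - s) * a2 by rewrite mulrBr tal mulr1 alE; lra.
have t01 : 0 <= t <= 1.
  rewrite -(pmulr_rge0 _ al0) tal mulr_ge0 ?(ltW a10)//=.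
  by rewrite -subr_ge0 -(pmulr_rge0 _ al0) e1 mulr_ge0 ?subr_ge0 ?(ltW a20).
have alg (D x1 x2 x3 x4 x5 x6 : R) :
    al * (x1 + x4) <= al * (t * x2 + (1 - t) * x3 + (t * x5 + (1 - t) * x6)) ->
    D + al * (x1 + x4 + 2 * r) - c <=
    s * (D + a1 * (x2 + x5 + 2 * r) - c) +
    (1 - s) * (D + a2 * (x3 + x6 + 2 * r) - c).
  have -> : al * (t * x2 + (1 - t) * x3 + (t * x5 + (1 - t) * x6)) =
      s * a1 * (x2 + x5) + (1 - s) * a2 * (x3 + x6) by rewrite -tal -e1; ring.
  have : al * r = (s * a1 + (1 - s) * a2) * r by rewrite alE.
  lra.
exists (fun w => t * psi1 w + (1 - t) * psi2 w, al).
  by split => //=; exact: fin_dim_space_comb.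
move=> z [z1 z2].
have N1 := fin_dim_spaceN F_space F1; have N2 := fin_dim_spaceN F_space F2.
have h1 := log_moment_convex p_density F_space good N1 N2 (AX_sub_M z1) t01.
have h2 := log_moment_convex p_density F_space good F1 F2 (AX_sub_M z2) t01.
apply: alg; apply: ler_wpM2l (ltW al0) _ _ _; apply: le_trans (lerD h1 h2).
suff -> : (fun w => - (t * psi1 w + (1 - t) * psi2 w)) =
  (fun w => t * (- psi1 w) + (1 - t) * (- psi2 w)) by [].
by apply/funext => w; ring.
Qed.

Lemma log_moment_continuous phi x : F phi -> X x ->
  {for x, continuous (fun y => L phi (A y))}.
Proof.
have [[oM cM] _ _ _] := good => Fphi Xx.
apply: (@continuous_comp _ _ _ A (L phi)); first exact: affine_map_continuous.
exact: (concave_continuous oM cM (log_moment_concave good Fphi) (AX_sub_M Xx)).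
Qed.

(** A strict inequality at one point spreads to a neighbourhood by continuity, which is the local
    hypothesis of [compact_minimax]. *)
Lemma saddle_near_neg r c t z : saddle_domain t -> (X `*` X) z ->
  saddle r c t z < 0 -> \forall y \near z, saddle r c t y <= 0.
Proof.
move: t => [psi al] [/= Fpsi _] [z1 z2] H.
have FN := fin_dim_spaceN F_space Fpsi.
have c1 : {for z, continuous (fun y : 'rV[R]_n * 'rV[R]_n =>
    L (fun w => - psi w) (A y.1))}.
  apply: (@continuous_comp _ _ _ fst (fun y => L (fun w => - psi w) (A y))).
    exact: cvg_fst.
  exact: log_moment_continuous.
have c2 : {for z, continuous (fun y : 'rV[R]_n * 'rV[R]_n => L psi (A y.2))}.
  apply: (@continuous_comp _ _ _ snd (fun y => L psi (A y))).
    exact: cvg_snd.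
  exact: log_moment_continuous.
have c3 : {for z, continuous (fun y : 'rV[R]_n * 'rV[R]_n => lin_form g y.1)}.
  apply: (@continuous_comp _ _ _ fst (lin_form g)); first exact: cvg_fst.
  exact: lin_form_continuous.
have c4 : {for z, continuous (fun y : 'rV[R]_n * 'rV[R]_n => lin_form g y.2)}.
  apply: (@continuous_comp _ _ _ snd (lin_form g)); first exact: cvg_snd.
  exact: lin_form_continuous.
have : saddle r c (psi, al) y @[y --> z] --> saddle r c (psi, al) z.
  exact: (cvgB (cvgD (cvgB c3 c4) (cvgMl_tmp (a := al)
    (cvgD (cvgD c1 c2) (cvg_cst (2 * r))))) (cvg_cst c)).
move=> /cvgr_lt /(_ 0 H); apply: filterS => y; exact: ltW.
Qed.

(** * Lower bound on the risk by two-point tests *)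

Lemma sup_prob_lt (ghat : Omega -> R) (delta eps : R) x : X x ->
  (worst_error ghat delta < eps%:E)%E ->
  (prob_dens P (p (A x)) [set w | (delta < `|ghat w - lin_form g x|)%R] < eps%:E)%E.
Proof. by move=> Xx; apply: le_lt_trans; apply: ereal_sup_ubound; exists x. Qed.

Lemma measurable_error_set (ghat : Omega -> R) (delta c : R) :
  measurable_fun setT ghat -> measurable [set w | delta < `|ghat w - c|].
Proof.
move=> mg; apply: measurable_gtr.
by apply: measurableT_comp => //; apply: measurable_funB.
Qed.

Lemma log_affinity_lt_risk (ghat : Omega -> R) (delta eps : R) x y :
  measurable_fun setT ghat -> 0 < eps -> X x -> X y ->
  (worst_error ghat delta < eps%:E)%E ->
  2 * delta < lin_form g x - lin_form g y ->
  2 * aff (A x) (A y) < ln (4 * eps).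
Proof.
move=> mg eps0 Xx Xy H gxy.
have Mx := AX_sub_M Xx; have My := AX_sub_M Xy.
have lt : moment (P := P) (p := p) (half_llr (p := p) (A x) (A y)) (A x) <
    2 * Num.sqrt eps.
  apply: (log_affinity_lt_test p_density F_space good Mx My _ _ _ eps0
    (sup_prob_lt Xx H) (sup_prob_lt Xy H)).
  - exact: measurable_error_set.
  - exact: measurable_error_set.
  (* Outside both error sets [ghat w] would be within [delta] of both values of the linear form,
     which are more than [2 delta] apart. *)
  - apply/seteqP; split => // w _ /=.
    have [|h1] := ltP delta `|ghat w - lin_form g x|; first by left.
    have [|h2] := ltP delta `|ghat w - lin_form g y|; first by right.
    by move: h1 h2; rewrite !ler_norml; lra.
have m0 := moment_gt0 p_density F_space good (half_llr_in F_space good Mx My) Mx.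
have -> : 4 * eps = (2 * Num.sqrt eps) ^+ 2.
  by rewrite exprMn sqr_sqrtr ?(ltW eps0)// -natrX.
have s0 : 0 < 2 * Num.sqrt eps by rewrite mulr_gt0// sqrtr_gt0.
by rewrite lnXn// -[ltRHS]mulr_natl ltr_pM2l// ltr_ln.
Qed.

Lemma lin_form_le_risk (ghat : Omega -> R) (delta eps : R) x y :
  measurable_fun setT ghat -> 0 < eps -> eps < 1 / 4 -> X x -> X y ->
  (worst_error ghat delta < eps%:E)%E ->
  - ln (2 / eps) <= aff (A x) (A y) ->
  lin_form g x - lin_form g y <= 2 * (theta eps * delta).
Proof.
move=> mg eps0 eps4 Xx Xy H affr.
have Mx := AX_sub_M Xx; have My := AX_sub_M Xy.
set r := ln (2 / eps) in affr *.
have [s sE] : exists s, s = ln (1 / (4 * eps)) by eexists.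
have sN : ln (4 * eps) = - s by rewrite sE div1r lnV ?opprK// posrE; lra.
have s0 : 0 < s by rewrite sE ln_gt0// div1r invf_gt1; lra.
have sr : s <= r.
  rewrite sE /r ler_ln ?posrE ?divr_gt0//; last lra.
  rewrite ler_pdivrMr; last lra.
  by rewrite (_ : 2 / eps * (4 * eps) = 8); [lra|field; lra].
(* [t] is the inverse of [theta eps]. The point at fraction [t] from [y] to [x] keeps log-affinity
   at least [- t r = - s / 2], while a gap above [2 theta delta] would shrink only to one above
   [2 delta], contradicting the test bound. *)
have [t [tE t01]] : exists t, 2 * r * t = s /\ 0 <= t <= 1.
  exists (s / (2 * r)); split; first by rewrite mulrC divfK// gt_eqF//; lra.
  by rewrite divr_ge0 ?ler_pdivrMr; lra.
have Xz : X (t *: x + (1 - t) *: y) by exact: X_convex.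
have := log_affinity_segment p_density F_space good Mx My t01.
rewrite -affine_map_segment => seg.
rewrite leNgt; apply/negP => lt.
have : 2 * delta < lin_form g (t *: x + (1 - t) *: y) - lin_form g y.
  rewrite lin_form_segment.
  have th : theta eps * t = 1.
    rewrite /theta -sE -/r mulrAC tE divff// gt_eqF//.
  have t0 : 0 < t by rewrite -(pmulr_rgt0 _ (_ : 0 < 2 * r)) ?tE//; lra.
  have : t * (2 * (theta eps * delta)) = 2 * delta.
    by rewrite -[in RHS](mul1r delta) -th; ring.
  by move: lt; rewrite -(ltr_pM2l t0); lra.
move=> /(log_affinity_lt_risk mg eps0 Xz Xy H); rewrite sN.
have := ler_wpM2l (proj1 (andP t01)) affr.
move: seg; move: (aff _ _) (aff _ _) => u v; lra.
Qed.

(** * Upper bound on the affine risk *)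

Lemma exists_saddle (ghat : Omega -> R) (delta eps c : R) :
  measurable_fun setT ghat -> 0 < eps -> eps < 1 / 4 ->
  (worst_error ghat delta < eps%:E)%E ->
  2 * (theta eps * delta) < c ->
  exists2 t, saddle_domain t &
    forall z, (X `*` X) z -> saddle (ln (2 / eps)) c t z <= 0.
Proof.
move=> mg eps0 eps4 H dc; have [_ _ FC] := F_space.
apply: compact_minimax.
- exact: compact_setX.
- by exists (fun=> 0, 1); split => //=.
- exact: saddle_concavelike.
- exact: saddle_convexlike.
move=> [x y] [/= Xx Xy]; have Mx := AX_sub_M Xx; have My := AX_sub_M Xy.
have Fh := half_llr_in F_space good My Mx.
suff [al al0 neg] : exists2 al, 0 < al &
    lin_form g x - lin_form g y + al * (2 * (aff (A x) (A y) + ln (2 / eps))) - c < 0.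
  exists (half_llr (p := p) (A y) (A x), al); first by split.
  apply: saddle_near_neg => //; move: neg.
  rewrite /saddle/= -(half_llrN good My Mx) -(log_affinity_sym good Mx My).
  by apply: le_lt_trans; rewrite -/(aff (A x) (A y)); lra.
(* If the log-affinity is at least [- r], the gap is already below [c] and a small [al] keeps the
   sum negative; the [+ 1] in its denominator covers [k = 0]. Otherwise the coefficient of [al] is
   negative and a large [al] outweighs the gap. *)
have [affr|affr] := leP (- ln (2 / eps)) (aff (A x) (A y)).
  have := lin_form_le_risk mg eps0 eps4 Xx Xy H affr.
  move: (lin_form _ _) (lin_form _ _) (aff _ _) affr => v u w affr uv.
  have [k [kE k0]] : exists k, k = 2 * (w + ln (2 / eps)) /\ 0 <= k.
    by eexists; split; first reflexivity; lra.
  exists ((c - (u - v)) / (k + 1)); first by apply: divr_gt0; lra.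
  rewrite -kE; have : (c - (u - v)) / (k + 1) * k < c - (u - v); last lra.
  by rewrite mulrAC ltr_pdivrMr; nra.
move: (lin_form _ _) (lin_form _ _) (aff _ _) affr => v u w affr.
have [k [kE k0]] : exists k, k = - (2 * (w + ln (2 / eps))) /\ 0 < k.
  by eexists; split; first reflexivity; lra.
exists ((`|u - v - c| + 1) / k); first by rewrite divr_gt0// ltr_wpDl.
rewrite (_ : 2 * _ = - k); last by rewrite kE opprK.
rewrite mulrN divfK ?gt_eqF//; have := ler_norm (u - v - c); lra.
Qed.

Lemma riskA_le_saddle (eps c kappa : R) t : 0 < eps -> 0 < kappa ->
  saddle_domain t ->
  (forall z, (X `*` X) z -> saddle (ln (2 / eps)) c t z <= 0) ->
  (riskA P p F X B a g eps <= (c / 2 + kappa)%:E)%E.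
Proof.
move: t => [psi al] eps0 kappa0 [/= Fpsi al0] H.
have FN := fin_dim_spaceN F_space Fpsi; have [_ mF FC] := F_space.
set r := ln (2 / eps) in H.
pose u x := lin_form g x + al * L (fun w => - psi w) (A x) + al * r.
(* The saddle function splits into a part in [x] and a part in [y], so the bound [c] can be divided
   into [U] and [c - U]. *)
have [U [uU Uv]] : exists U, (forall x, X x -> u x <= U) /\
    forall y, X y -> - lin_form g y + al * L psi (A y) + al * r <= c - U.
  have [x0 Xx0] := X_nonempty.
  have ub y : X y -> ubound (u @` X)
      (c - (- lin_form g y + al * L psi (A y) + al * r)).
    move=> Xy _ [x Xx <-]; have := H (x, y) (conj Xx Xy).
    by rewrite /saddle/u/=; do 2 move: (L _ _) => ?; lra.
  exists (sup (u @` X)); split => [x Xx|y Xy].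
    apply: ub_le_sup; last by exists x.
    by exists (c - (- lin_form g x0 + al * L psi (A x0) + al * r)); exact: ub.
  have : sup (u @` X) <= c - (- lin_form g y + al * L psi (A y) + al * r).
    by apply: ge_sup; [exists (u x0), x0 | exact: ub].
  by move: (sup _) => ?; move: (L _ _) => ?; lra.
(* The shift centres the estimate, so that overestimation and underestimation get the same tolerance
   [c / 2]. *)
pose ghat w := al * psi w + 1 * ((U - (c - U)) / 2).
have Fg : F ghat by exact: (fin_dim_space_comb F_space al 1 Fpsi (FC _)).
apply: (@le_trans _ _ (risk P p X B a g ghat eps)).
  by apply: ereal_inf_lbound; exists ghat.
apply: ereal_inf_lbound; exists (c / 2 + kappa) => //=.
have er : expR (- r) = eps / 2.
  by rewrite expRN lnK ?invf_div// posrE divr_gt0.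
apply: (@le_lt_trans _ _ (eps * expR (- (kappa / al)))%:E); last first.
  by rewrite lte_fin gtr_pMr// expR_lt1 oppr_lt0 divr_gt0.
apply: ge_ereal_sup => _ [x Xx <-]; have Mx := AX_sub_M Xx.
(* [b1] and [b2] are the Chernoff exponents for underestimation and overestimation; each tail gets
   half of the bound. *)
pose b1 := (lin_form g x - U - kappa) / al.
pose b2 := (- lin_form g x - (c - U) - kappa) / al.
apply: le_trans (prob_dens_le_moment (phi1 := fun w => - psi w) (phi2 := psi)
  (c1 := expR b1) (c2 := expR b2) p_density F_space good FN Fpsi Mx _ _ _ _) _.
- by apply: measurable_error_set; exact: mF.
- exact: expR_ge0.
- exact: expR_ge0.
- move=> w /= lt; rewrite -!expRD.
  have := expR_ge0 (b1 + - psi w); have := expR_ge0 (b2 + psi w).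
  have main (b q : R) : 0 <= al * q + al * b -> 1 <= expR (b + q).
    rewrite -mulrDr pmulr_rge0// addrC => h; rewrite -expR0 ler_expR//.
  have alb z : al * (z / al) = z by rewrite mulrC divfK ?gt_eqF.
  move: lt; rewrite ltr_normr => /orP[] lt.
    suff : 1 <= expR (b2 + psi w) by lra.
    by apply: main; rewrite /b2 alb; move: lt; rewrite /ghat; lra.
  suff : 1 <= expR (b1 + - psi w) by lra.
  by apply: main; rewrite /b1 alb; move: lt; rewrite /ghat; lra.
rewrite lee_fin -(expR_log_moment p_density F_space good FN Mx).
rewrite -(expR_log_moment p_density F_space good Fpsi Mx) -!expRD.
have -> : eps * expR (- (kappa / al)) =
    expR (- r - kappa / al) + expR (- r - kappa / al).
  by rewrite expRD er; lra.
apply: lerD; rewrite ler_expR -(ler_pM2l al0) mulrDr mulrBr mulrN /b1 /b2.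
  rewrite ![al * (_ / al)]mulrC !divfK ?gt_eqF//.
  by have := uU x Xx; rewrite /u; move: (L _ _) => ?; lra.
rewrite ![al * (_ / al)]mulrC !divfK ?gt_eqF//.
by have := Uv x Xx; move: (L _ _) => ?; lra.
Qed.

Lemma riskA_le_theta_risk (ghat : Omega -> R) (eps : R) :
  measurable_fun setT ghat -> 0 < eps -> eps < 1 / 4 ->
  (riskA P p F X B a g eps <= (theta eps)%:E * risk P p X B a g ghat eps)%E.
Proof.
move=> mg eps0 eps4.
have th0 := theta_gt0 eps0 eps4.
(* Dividing by the positive [theta eps] leaves a lower bound for an infimum, so one admissible
   [delta] can be treated at a time. The slack [e] is shared equally between [c / 2] and [kappa]. *)
rewrite -lee_pdivrMl//; apply/ereal_infP => _ [delta /= H <-].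
rewrite lee_pdivrMl//; apply/lee_addgt0Pr => e e0.
have dc : 2 * (theta eps * delta) < 2 * (theta eps * delta) + e by lra.
have [t dt Ht] := exists_saddle mg eps0 eps4 H dc.
apply: le_trans (riskA_le_saddle eps0 (_ : 0 < e / 2) dt Ht) _; first lra.
by rewrite -EFinM -EFinD lee_fin; lra.
Qed.

End Risk.

Unset Implicit Arguments.

Theorem theorem3p1
  (R : realType) (T : completePseudoMetricType R)
  (T_hausdorff : hausdorff_space T) (T_separable : separable_space T)
  (P : {measure set (borel_space T) -> \bar R})
  (P_sigma_finite : sigma_finite setT P)
  (m : nat) (M : set 'rV[R]_m) (p : 'rV[R]_m -> borel_space T -> R)
  (p_density : forall mu, M mu -> is_density P (p mu))
  (F : set (borel_space T -> R)) (F_space : fin_dim_space F)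
  (good : good_pair P M p F)
  (n : nat) (X : set 'rV[R]_n) (B : 'M[R]_(n, m)) (a : 'rV[R]_m)
  (g : 'rV[R]_n)
  (X_nonempty : X !=set0) (X_convex : convex_rV X) (X_compact : compact X)
  (AX_sub_M : forall x, X x -> M (affine_map B a x))
  (eps : R) (eps_pos : 0 < eps) (eps_lt : eps < 1 / 4) :
  (riskA P p F X B a g eps <= (theta eps)%:E * risk_star P p X B a g eps)%E.
Proof.
have th0 := theta_gt0 eps_pos eps_lt.
rewrite -lee_pdivrMl//; apply/ereal_infP => _ [ghat mg <-].
rewrite lee_pdivrMl//.
exact: (riskA_le_theta_risk p_density F_space good).
Qed.
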